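(* Let $X$ be a real locally convex Hausdorff topological vector space with topological dual $Y=X^\prime$. Let $C\subseteq X$ be a closed convex cone in $X$ and $D\subseteq Y$ a closed convex cone in $Y$. Then the following are equivalent: (i) $D=C^\prime$; (ii) $C=D^\prime$. If, in addition, $C$ and $D^\prime$ have nonempty interior with respect to a consistent locally convex topology $\tau$ on $X$, then (i) and (ii) are also equivalent to: (iii) $\mathrm{int}(C)=\{x\in X:\ \forall y\in D\setminus\{0\},\ \langle x,y\rangle>0\}$, where $\mathrm{int}$ denotes the interior with respect to $\tau$.
   Context: Write $\langle x,y\rangle:=y(x)$ for $x\in X$, $y\in Y=X^\prime$. The spaces $X$ and $Y$ are endowed with the weak topology $\sigma(X,Y)$ and the weak$^\star$ topology $\sigma(Y,X)$, respectively, and ''closed'' refers to these topologies. A nonempty subset $C$ of a real vector space is a cone if $\lambda C\subseteq C$ for all real $\lambda>0$. For a nonempty $S\subseteq X$, its dual cone is $S^\prime:=\{y\in Y:\ \forall x\in S,\ \langle x,y\rangle\ge 0\}$; symmetrically, for a nonempty $T\subseteq Y$, $T^\prime:=\{x\in X:\ \forall y\in T,\ \langle x,y\rangle\ge 0\}$. A locally convex topology $\tau$ on $X$ is consistent if the topological dual of $(X,\tau)$ coincides with $X^\prime=Y$. *)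

(* Defs.v *)
From HB Require Import structures.
From mathcomp Require Import all_boot all_order all_algebra.
From mathcomp Require Import all_classical all_reals all_analysis.

Set Implicit Arguments.
Unset Strict Implicit.
Unset Printing Implicit Defensive.

Import Order.TTheory GRing.Theory Num.Theory.
Import numFieldNormedType.Exports.

Local Open Scope classical_set_scope.
Local Open Scope ring_scope.

Definition continuous_functional (R : realType) (X : preTopologicalLmodType R)
    : set (X -> R^o) :=
  [set f | linear f /\ continuous f].

Section topological_dual.
Context (R : realType) (X : preTopologicalLmodType R).

Definition dual_pred : {pred X -> R^o} :=
  fun f => `[< continuous_functional f >].

Lemma dual_submod_closed : submod_closed dual_pred.
Proof.
split.
  apply/asboolP; split; first by move=> a u v /=; rewrite scaler0 addr0.
  by move=> x; exact: cvg_cst.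
move=> a f g /asboolP[lf cf] /asboolP[lg cg]; apply/asboolP; split.
  move=> b u v; rewrite /= !fctE lf lg !scalerDr.
  by rewrite addrACA !scalerA (mulrC a).
move=> x; apply: cvgD; last exact: cg.
by apply: cvgZl_tmp; exact: cf.
Qed.

HB.instance Definition _ :=
  GRing.isSubmodClosed.Build R (X -> R^o) dual_pred dual_submod_closed.

Record dual_space := DualSpace {
  functional :> X -> R^o;
  functionalP : functional \in dual_pred }.

HB.instance Definition _ := [isSub for functional].
HB.instance Definition _ := [Choice of dual_space by <:].
HB.instance Definition _ := [SubChoice_isSubLmodule of dual_space by <:].

Definition pairing (x : X) (y : dual_space) : R := y x.

(* A supremum of initial topologies: the coarsest topology making the listed
   maps continuous. *)
Definition weak_topology : Type :=
  sup_topology (fun y : dual_space =>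
    Topological.class (initial_topology (fun x : X => pairing x y : R^o))).

HB.instance Definition _ := Topological.on weak_topology.

Definition weak_star_topology : Type :=
  sup_topology (fun x : X =>
    Topological.class
      (initial_topology (fun y : dual_space => pairing x y : R^o))).

HB.instance Definition _ := Topological.on weak_star_topology.

Definition dual_cone (S : set X) : set dual_space :=
  [set y | forall x, S x -> 0 <= pairing x y].

Definition predual_cone (T : set dual_space) : set X :=
  [set x | forall y, T y -> 0 <= pairing x y].

End topological_dual.

Definition cone (R : realType) (V : lmodType R) (C : set V) : Prop :=
  C !=set0 /\ forall (l : R) x, 0 < l -> C x -> C (l *: x).

(* The vector space X with its own topology, if any, replaced by tau. *)
Definition retopologize (X : Type) (tau : Topological X) : Type := X.

Section retopologize.
Context (R : realType) (X : lmodType R) (tau : Topological X).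
Let T : topologicalType := Topological.Pack tau.

HB.instance Definition _ := GRing.Lmodule.copy (retopologize tau) X.
HB.instance Definition _ := hasNbhs.Build (retopologize tau) (@nbhs T T).
HB.instance Definition _ := Nbhs_isTopological.Build (retopologize tau)
  (@nbhs_pfilter T) (@topology_structure.nbhsE_subproof T)
  (@topology_structure.openE T).

End retopologize.

(* The axioms of tvsType, for the topology tau. *)
Definition locally_convex_topology (R : realType) (X : lmodType R)
    (tau : Topological X) : Prop :=
  let E : preTopologicalLmodType R := retopologize tau in
  [/\ continuous (fun x : E * E => x.1 + x.2),
      continuous (fun z : R^o * E => z.1 *: z.2) &
      exists2 B : set_system E, (forall b, b \in B -> convex_set b) & basis B].

Definition consistent (R : realType) (X : preTopologicalLmodType R)
    (tau : Topological X) : Prop :=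
  @continuous_functional R (retopologize tau) = @continuous_functional R X.

(* Main.v *)
Require Import Defs.
From HB Require Import structures.
From mathcomp Require Import all_boot all_order all_algebra.
From mathcomp Require Import all_classical all_reals all_analysis.
From mathcomp Require Import ring lra.

Set Implicit Arguments.
Unset Strict Implicit.
Unset Printing Implicit Defensive.

Import Order.TTheory GRing.Theory Num.Theory.
Import numFieldNormedType.Exports.

Local Open Scope classical_set_scope.
Local Open Scope ring_scope.

(** The equivalence of the first two conditions is the bipolar theorem, applied
    once in X and once in its dual.  Both instances are the same statement about
    a bilinear pairing B of two vector spaces V and W ([weak_separation]): a
    point outside a weakly closed convex cone C is separated from C by some
    B(_, w).  It rests on two facts.
    - A Hahn-Banach theorem in the form due to Krein and Kantorovich
      ([positive_functional]): if a convex cone K contains e in its algebraic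
      interior but does not contain - e, some linear functional is nonnegative
      on K and equal to 1 at e.
    - A linear functional that vanishes on the common kernel of finitely many
      B(_, w) is itself of this form ([functional_of_kernel]).
    To separate x from C, the first fact is applied with e = - x and K the cone
    generated by C and a weak neighbourhood of - x.

    For the third condition, let A be a convex cone with nonempty interior.
    Then int A is the set of the points at which every nonzero continuous
    functional that is nonnegative on A is positive ([interior_dual_cone]).  On
    the one hand such a functional decreases strictly in some direction, and an
    interior point of A can be moved a little in that direction within A.  On
    the other hand a point x outside int A is separated from A by the
    functional obtained from [positive_functional] with e interior to A and K
    generated by A and - x; it is continuous for tau because it is nonnegative
    on a set with interior, hence belongs to the dual of X because tau is
    consistent.

    Applied to C, this shows that D = C' implies the third condition.
    Conversely, applied to D', whose dual cone is D by the bipolar theorem, it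
    turns the third condition into int C = int D'; and a closed convex cone with
    nonempty interior is determined by its interior, whence C = D'. *)

(** * Hahn-Banach for convex cones *)

Definition convex_cone (R : realType) (V : lmodType R) (K : set V) : Prop :=
  [/\ K 0, forall (l : R) x, 0 < l -> K x -> K (l *: x)
     & forall x y, K x -> K y -> K (x + y)].

Lemma cone_convex_cone (R : realType) (V : lmodType R) (K : set V) :
  cone K -> convex_set K -> K 0 -> convex_cone K.
Proof.
move=> [_ Kl] Kc K0; split => // x y Kx Ky.
have h0 : 0 <= (2^-1 : R) by rewrite invr_ge0.
have h1 : (2^-1 : R) <= 1 by rewrite invf_le1// ler1n.
(* A sum is twice a midpoint. *)
have <- : 2^-1 *: (2 *: x) + (1 - 2^-1) *: (2 *: y) = x + y.
  rewrite !scalerA mulrBl mul1r mulVf// scale1r; congr (_ + _).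
  by rewrite (_ : 2 - 1 = 1 :> R) ?scale1r//; ring.
have := Kc (2 *: x) (2 *: y) (Itv01 h0 h1).
by rewrite !inE; apply; exact: Kl.
Qed.

Section order_unit.
Context (R : realType) (V : lmodType R).
Implicit Types (K N : set V) (u v e : V).

(** A cone maximal among those that contain K but not - e is as large as a
    half-space: if it contained neither v nor - v, adjoining either would
    produce - e, and v cancels in a positive combination of the two resulting
    expressions of - e. *)
Lemma maximal_convex_cone K e : convex_cone K -> ~ K (- e) ->
  exists M, [/\ convex_cone M, K `<=` M, ~ M (- e)
    & forall v, M v \/ M (- v)].
Proof.
move=> Kc Ke; have [K0 Kl Kd] := Kc.
(* The order is on the part added to K, so that the empty chain has an upper
   bound, the union of no sets. *)
pose P := [set A | convex_cone (K `|` A) /\ ~ A (- e)].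
have [F FP Ftot|A [[Mc Ae] Amax]] := @Zorn_bigcup V P.
  split; last by move=> [A /FP[_ Ae]] /Ae.
  split; first by left.
  - move=> l x l0 [Kx|[A FA Ax]]; first by left; exact: Kl.
    have [[_ Al _] _] := FP A FA.
    by have [] := Al l x l0 (or_intror Ax); [left|right; exists A].
  - have add A x y : F A -> (K `|` A) x -> (K `|` A) y ->
        (K `|` \bigcup_(X in F) X) (x + y).
      move=> FA Ax Ay; have [[_ _ Ad] _] := FP A FA.
      by have [] := Ad x y Ax Ay; [left|right; exists A].
    move=> x y [Kx|[A FA Ax]] [Ky|[B FB By]].
    + by left; exact: Kd.
    + by apply: (add B) => //; [left|right].
    + by apply: (add A) => //; [right|left].
    + have [AB|BA] := Ftot A B FA FB.
        by apply: (add B) => //; right => //; exact: AB.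
      by apply: (add A) => //; right => //; exact: BA.
set M := K `|` A in Mc.
have Me : ~ M (- e) by case.
have max N : convex_cone N -> M `<=` N -> ~ N (- e) -> N `<=` M.
  move=> Nc MN Ne; apply: contrapT => NM; apply: (Amax N).
    split; last by move=> NA; apply: NM => x /NA; right.
    by move=> x Ax; apply: MN; right.
  split=> //; suff -> : K `|` N = N by [].
  by apply/setUidr => x Kx; apply: MN; left.
have [M0 Ml Md] := Mc.
have adjoin v : ~ M v ->
    exists2 s : R, 0 < s & exists2 m, M m & - e = m + s *: v.
  move=> Mv; pose N := [set m + s *: v | m in M & s in [set s : R | 0 <= s]].
  have Nc : convex_cone N.
    split.
    - by exists 0 => //; exists 0 => //=; rewrite scale0r addr0.
    - move=> l _ l0 [m Mm [s /= s0 <-]]; exists (l *: m); first exact: Ml.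
      exists (l * s); first by rewrite /= mulr_ge0// ltW.
      by rewrite scalerDr scalerA.
    - move=> _ _ [m Mm [s /= s0 <-]] [m' Mm' [s' /= s'0 <-]].
      exists (m + m'); first exact: Md.
      exists (s + s'); first by rewrite /= addr_ge0.
      by rewrite scalerDl addrACA.
  have MN : M `<=` N.
    by move=> m Mm; exists m => //; exists 0 => //=; rewrite scale0r addr0.
  have Nv : N v by exists 0 => //; exists 1 => //=; rewrite scale1r add0r.
  have [[m Mm [s /= s0 es]]|Ne] := pselect (N (- e)); last first.
    by case: Mv; exact: (max N).
  exists s; last by exists m.
  rewrite lt_neqAle s0 andbT eq_sym; apply/eqP => sE; apply: Me.
  by rewrite -es sE scale0r addr0.
exists M; split => //; first by move=> x Kx; left.
move=> v; apply: contrapT => /not_orP[/adjoin[s s0 [m Mm em]]].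
move=> /adjoin[t t0 [n Mn en]]; apply: Me.
have -> : - e = (s + t)^-1 *: (t *: m + s *: n).
  apply: (@scalerI _ _ (s + t)); first by rewrite gt_eqF// addr_gt0.
  rewrite scalerA divff ?gt_eqF ?addr_gt0// scale1r.
  have -> : (s + t) *: - e = t *: (m + s *: v) + s *: (n + t *: - v).
    by rewrite -em -en -scalerDl addrC.
  by rewrite !scalerDr !scalerN !scalerA (mulrC t s) addrACA subrr addr0.
by apply: (Ml); [rewrite invr_gt0 addr_gt0|apply: Md; exact: Ml].
Qed.

(** Order V by a maximal cone M.  Since e is an order unit and every vector is
    comparable to 0, each v determines a cut of the real line, between the r
    such that r e lies below v and those such that r e lies above v; the value
    of the functional at v is the place of this cut. *)
Lemma positive_functional K e : convex_cone K -> ~ K (- e) ->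
    (forall v, exists2 t : R, 0 < t & K (e + t *: v)) ->
  exists g : V -> R^o, [/\ linear g, forall v, K v -> 0 <= g v & g e = 1].
Proof.
move=> Kc Ke unit; have [M [Mc KM Me Mtot]] := maximal_convex_cone Kc Ke.
have [M0 Ml Md] := Mc.
have Me1 : M e by have [t _ /KM] := unit 0; rewrite scaler0 addr0.
have Mle (a : R) : M (a *: e) -> 0 <= a.
  move=> Ma; rewrite leNgt; apply/negP => a0; apply: Me.
  have -> : - e = (- a)^-1 *: (a *: e).
    by rewrite scalerA invrN mulNr mulVf ?lt_eqF// scaleN1r.
  by apply: Ml => //; rewrite invr_gt0 oppr_gt0.
have lower v : exists r, M (v - r *: e).
  have [t t0 /KM Mt] := unit v; exists (- t^-1).
  rewrite scaleNr opprK addrC; have : M (t^-1 *: (e + t *: v)).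
    by apply: Ml => //; rewrite invr_gt0.
  by rewrite scalerDr scalerA mulVf ?gt_eqF// scale1r.
have cut v r s : M (v - r *: e) -> M (s *: e - v) -> r <= s.
  move=> Mr Ms; rewrite -subr_ge0; apply: Mle.
  by rewrite scalerBl -(subrKA v); exact: Md.
have sups v : has_sup [set r | M (v - r *: e)].
  split; first exact: lower.
  have [r Mr] := lower (- v); exists (- r) => s /cut; apply.
  by rewrite scaleNr addrC.
pose g v : R^o := sup [set r | M (v - r *: e)].
have below v r : r < g v -> M (v - r *: e).
  move=> rg; have [s Ms rs] := sup_gt (sups v).1 rg.
  have -> : v - r *: e = (v - s *: e) + (s - r) *: e.
    by rewrite scalerBl addrA subrK.
  by apply: Md => //; apply: Ml => //; rewrite subr_gt0.
have above v r : g v < r -> M (r *: e - v).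
  move=> gr; have [Mr|] := Mtot (v - r *: e); last by rewrite opprB.
  by have := ub_le_sup (sups v).2 Mr; rewrite leNgt gr.
have gE v a : (forall d, 0 < d -> M (v - (a - d) *: e)) ->
    (forall d, 0 < d -> M ((a + d) *: e - v)) -> g v = a.
  move=> lo up; apply/eqP; rewrite eq_le; apply/andP; split.
    apply/ler_addgt0Pr => d d0; apply: ge_sup; first exact: (sups v).1.
    by move=> r /cut; apply; exact: up.
  apply/ler_addgt0Pr => d d0; rewrite -lerBlDr.
  by apply: ub_le_sup; [exact: (sups v).2|exact: lo].
have gD u v : g (u + v) = g u + g v.
  apply: gE => d d0.
    have -> : u + v - (g u + g v - d) *: e =
        (u - (g u - d / 2) *: e) + (v - (g v - d / 2) *: e).
      by rewrite addrACA -opprD -scalerDl; congr (_ - _ *: _); field.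
    by apply: Md; apply: below; rewrite ltrBlDr ltrDl divr_gt0.
  have -> : (g u + g v + d) *: e - (u + v) =
      ((g u + d / 2) *: e - u) + ((g v + d / 2) *: e - v).
    by rewrite addrACA -opprD -scalerDl; congr (_ *: _ - _); field.
  by apply: Md; apply: above; rewrite ltrDl divr_gt0.
have g0 : g 0 = 0.
  by have /eqP := gD 0 0; rewrite addr0 -subr_eq subrr eq_sym => /eqP.
have gN v : g (- v) = - g v.
  by apply/eqP; rewrite -addr_eq0 -gD addNr g0.
have gZp a v : 0 < a -> g (a *: v) = a * g v.
  move=> a0; apply: gE => d d0.
    have -> : a *: v - (a * g v - d) *: e = a *: (v - (g v - d / a) *: e).
      rewrite scalerBr scalerA; congr (_ - _ *: _).
      by field; rewrite gt_eqF.
    by apply: Ml => //; apply: below; rewrite ltrBlDr ltrDl divr_gt0.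
  have -> : (a * g v + d) *: e - a *: v = a *: ((g v + d / a) *: e - v).
    rewrite scalerBr scalerA; congr (_ *: _ - _).
    by field; rewrite gt_eqF.
  by apply: Ml => //; apply: above; rewrite ltrDl divr_gt0.
exists g; split.
- move=> a u v; rewrite gD; congr (_ + _); have [a0|a0|->] := ltgtP a 0.
  + by rewrite -[LHS]opprK -gN -scaleNr gZp ?oppr_gt0// mulNr opprK.
  + exact: gZp.
  + by rewrite !scale0r.
- move=> v /KM Mv; apply: ub_le_sup; first exact: (sups v).2.
  by rewrite /= scale0r subr0.
- apply: gE => d d0.
    rewrite -{1}[e]scale1r -scalerBl opprB addrC subrK.
    exact: Ml.
  by rewrite -{2}[e]scale1r -scalerBl addrAC subrr add0r; exact: Ml.
Qed.

End order_unit.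

(** * Separation by a bilinear pairing *)

Section pairing_separation.
Context (R : realType) (V W : lmodType R) (B : V -> W -> R^o).
Hypothesis linl : forall w, linear (B^~ w).
Hypothesis linr : forall v, linear (B v).

Let BD u v w : B (u + v) w = B u w + B v w.
Proof. by have := linl w 1 u v; rewrite !scale1r. Qed.

Let B0 w : B 0 w = 0.
Proof.
by apply/eqP; have /eqP := BD 0 0 w; rewrite addr0 -subr_eq subrr eq_sym.
Qed.

Let BZ (a : R) u w : B (a *: u) w = a * B u w.
Proof. by have := linl w a u 0; rewrite !addr0 B0 addr0. Qed.

Let BN u w : B (- u) w = - B u w.
Proof. by rewrite -scaleN1r BZ mulN1r. Qed.

Let B0r v : B v 0 = 0.
Proof. by have := linr v (-1) 0 0; rewrite scaler0 addr0 scaleN1r addNr. Qed.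

(** By induction on the list: choose u in the common kernel of the tail with
    B u w nonzero; subtracting from g the multiple of B(_, w) that agrees with g
    at u gives a functional that vanishes on the kernel of the tail.  If there
    is no such u, the head of the list does not cut the kernel down. *)
Lemma functional_of_kernel (s : seq W) (g : V -> R^o) : linear g ->
    (forall v, (forall w, w \in s -> B v w = 0) -> g v = 0) ->
  exists w, forall v, g v = B v w.
Proof.
elim: s g => [|w s IH] g lg kerg.
  by exists 0 => v; rewrite B0r; exact: kerg.
have [[u us u1]|nou] := pselect
    (exists2 u, (forall w', w' \in s -> B u w' = 0) & B u w != 0).
  pose h v : R^o := g v - g u / B u w * B v w.
  have [|v vs|w' hw'] := IH h.
  - move=> a x y; rewrite /h lg linl /GRing.scale/=; ring.
  - have /kerg : forall w', w' \in w :: s ->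
        B ((- (B v w / B u w)) *: u + v) w' = 0.
      move=> w'; rewrite inE BD BZ => /predU1P[->|w's]; first by field.
      by rewrite (us w')// (vs w')// mulr0 addr0.
    by rewrite lg /h /GRing.scale/= => <-; field.
  - exists (g u / B u w *: w + w') => v.
    by rewrite linr -hw' /h /GRing.scale/=; ring.
apply: IH => // v vs; apply: kerg => w'.
rewrite inE => /predU1P[->|]; last exact: vs.
by apply/eqP/negPn/negP => vw; apply: nou; exists v.
Qed.

Lemma common_bound (s : seq W) v :
  exists2 M : R, 0 < M & forall w, w \in s -> `|B v w| <= M.
Proof.
elim: s => [|w s [M M0 Ms]]; first by exists 1.
exists (M + `|B v w|); first by rewrite ltr_pwDl.
move=> w'; rewrite inE => /predU1P[->|/Ms]; first by rewrite lerDr ltW.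
by move/le_trans; apply; rewrite lerDl.
Qed.

(** This is closedness for the initial topology of the maps B(_, w), stated with
    its basic neighbourhoods; it lets the two sides of the duality share one
    separation theorem. *)
Definition weakly_closed (C : set V) : Prop := forall x, ~ C x ->
  exists s : seq W, exists2 eps : R, 0 < eps &
    forall z, (forall w, w \in s -> `|B (z - x) w| < eps) -> ~ C z.

(** A small enough positive multiple of any point of the cone enters a given
    weak neighbourhood of 0. *)
Lemma weakly_closed0 (C : set V) : cone C -> weakly_closed C -> C 0.
Proof.
move=> [[c Cc] Cl] Ccl; apply: contrapT => /Ccl[s [eps eps0]].
have [M M0 cM] := common_bound s c.
apply; last by apply: (Cl (eps / (M + M)) c) => //; rewrite divr_gt0// addr_gt0.
move=> w /cM cMw; rewrite subr0 BZ normrM gtr0_norm ?divr_gt0 ?addr_gt0//.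
have -> : eps / (M + M) * `|B c w| = eps * (`|B c w| / (M + M)) by ring.
by rewrite gtr_pMr// ltr_pdivrMr ?addr_gt0// mul1r (le_lt_trans cMw)// ltrDl.
Qed.

(** The functional produced by Hahn-Banach is bounded on a weak neighbourhood of
    0, so it vanishes on the common kernel of finitely many B(_, w). *)
Lemma weak_separation (C : set V) x :
    convex_cone C -> weakly_closed C -> ~ C x ->
  exists w, (forall c, C c -> 0 <= B c w) /\ B x w < 0.
Proof.
move=> [C0 Cl Cd] Ccl /Ccl[s [eps eps0 xC]].
(* For r > 0 these are the c + r u with c in C and u in the weak neighbourhood
   of - x of radius eps; multiplying the condition on u by r makes it additive
   in k, and includes r = 0. *)
pose K := [set k | exists c, C c /\ exists2 r : R, 0 <= r &
  forall w, w \in s -> `|B (k - c + r *: x) w| <= r * eps].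
have Kc : convex_cone K.
  split.
  - exists 0; split => //; exists 0 => // w _.
    by rewrite subr0 add0r scale0r B0 normr0 mul0r.
  - move=> l k l0 [c [Cc [r r0 kr]]]; exists (l *: c); split; first exact: Cl.
    exists (l * r); first by rewrite mulr_ge0// ltW.
    move=> w /kr; rewrite -scalerBr -scalerA -scalerDr BZ normrM gtr0_norm//.
    by rewrite -mulrA ler_pM2l.
  - move=> k k' [c [Cc [r r0 kr]]] [c' [Cc' [r' r'0 kr']]].
    exists (c + c'); split; first exact: Cd.
    exists (r + r'); first exact: addr_ge0.
    move=> w ws; rewrite opprD scalerDl (addrACA k) (addrACA (k - c)) BD mulrDl.
    by rewrite (le_trans (ler_normD _ _))// lerD// ?kr// kr'.
have CK : C `<=` K.
  move=> c Cc; exists c; split => //; exists 0 => // w _.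
  by rewrite subrr add0r scale0r B0 normr0 mul0r.
have Kx : ~ K (- - x).
  rewrite opprK => -[c [Cc [r r0 xr]]].
  have r1 : 0 < 1 + r by rewrite ltr_pwDl.
  apply: (xC ((1 + r)^-1 *: c)); last by apply: Cl => //; rewrite invr_gt0.
  have xE : x - c + r *: x = (1 + r) *: x - c.
    by rewrite addrAC scalerDl scale1r.
  move=> w /xr; rewrite xE => xrw.
  have -> : (1 + r)^-1 *: c - x = (- (1 + r)^-1) *: ((1 + r) *: x - c).
    rewrite scalerBr scalerA mulNr mulVf ?gt_eqF// scaleN1r scaleNr opprK.
    by rewrite addrC.
  have ri : 0 < (1 + r)^-1 by rewrite invr_gt0.
  rewrite BZ normrM normrN (gtr0_norm ri) mulrC ltr_pdivrMr//.
  by apply: le_lt_trans xrw _; nra.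
have absorb v (M : R) : 0 < M -> (forall w, w \in s -> `|B v w| <= M) ->
    K (- x + (eps / M) *: v).
  move=> M0 vM; exists 0; split => //; exists 1 => // w /vM vMw.
  rewrite subr0 scale1r addrAC addNr add0r mul1r BZ normrM.
  by rewrite gtr0_norm ?divr_gt0// mulrAC ler_pdivrMr// ler_pM2l.
have [|g [lg gK g1]] := positive_functional Kc Kx.
  move=> v; have [M M0 vM] := common_bound s v.
  by exists (eps / M); [exact: divr_gt0|exact: absorb].
have [v vs|w gw] := @functional_of_kernel s g lg.
  (* Along the common kernel the whole line from - x stays in K. *)
  have gv (n : R) : 0 <= 1 + n * g v.
    have -> : 1 + n * g v = g (n *: v - x).
      by rewrite lg g1 addrC.
    apply: gK; exists 0; split => //; exists 1 => // w ws.
    by rewrite subr0 scale1r subrK BZ (vs w)// mulr0 normr0 mul1r ltW.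
  apply/eqP/negPn/negP => gv0; have := gv (- 2 / g v).
  by rewrite divfK// leNgt => /negP; apply; lra.
exists w; split; first by move=> c /CK /gK; rewrite gw.
by rewrite -oppr_gt0 -BN -gw g1.
Qed.

End pairing_separation.

(** * Weak topologies and the bipolar theorem *)

Section weak_neighbourhoods.
Context (R : realType) (T : choiceType) (I : eqType) (f : I -> T -> R^o).

(** The sets that contain a basic neighbourhood of x form a filter, and it
    converges to x for each of the initial topologies, hence for their
    supremum. *)
Lemma nbhs_sup_initial (x : T) (A : set T) :
    @nbhs _ (sup_topology
      (fun i => Topological.class (initial_topology (f i)))) x A ->
  exists s : seq I, exists2 eps : R, 0 < eps &
    forall z, (forall i, i \in s -> `|f i z - f i x| < eps) -> A z.
Proof.
pose F := [set A : set T | exists s : seq I, exists2 eps : R, 0 < eps &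
  forall z, (forall i, i \in s -> `|f i z - f i x| < eps) -> A z].
have FF : Filter F.
  split.
  - by exists [::]; exists 1.
  - move=> P Q [s [eps eps0 sP]] [t [del del0 tQ]]; exists (s ++ t).
    exists (Num.min eps del); first by rewrite lt_min eps0.
    move=> z zst; split; [apply: sP|apply: tQ] => i hi.
      by have := zst i; rewrite mem_cat hi lt_min => /(_ isT)/andP[].
    by have := zst i; rewrite mem_cat hi orbT lt_min => /(_ isT)/andP[].
  - by move=> P Q PQ [s [eps eps0 sP]]; exists s; exists eps => // z /sP /PQ.
pose Tc i := Topological.class (initial_topology (f i)).
have /(cvg_sup Tc x FF) : forall i, F `=>` nbhs (x : initial_topology (f i)).
  move=> i P [_ [[U Uo <-] Ux] UP].
  have /nbhs_ballP[eps /= eps0 epsU] : nbhs (f i x) U by exact: open_nbhs_nbhs.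
  exists [:: i]; exists eps => // z zi; apply: UP; apply: epsU.
  by rewrite -ball_normE /= distrC zi// mem_seq1.
exact.
Qed.

End weak_neighbourhoods.

Section duality.
Context (R : realType) (X : preTopologicalLmodType R).
Implicit Types (C : set X) (D : set (dual_space X)).

Let pair (x : X) (y : dual_space X) : R^o := pairing x y.

Lemma pairing_linearl y : linear (pair^~ y).
Proof. by have /asboolP[] := functionalP y. Qed.

Lemma pairing_linearr x : linear (pair x).
Proof. by []. Qed.

Lemma pairingD (u v : X) (y : dual_space X) :
  pairing (u + v) y = pairing u y + pairing v y.
Proof. by have := pairing_linearl y 1 u v; rewrite !scale1r. Qed.

Lemma pairing0 (y : dual_space X) : pairing 0 y = 0.
Proof.
by apply/eqP; have /eqP := pairingD 0 0 y; rewrite addr0 -subr_eq subrr eq_sym.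
Qed.

Lemma pairingZ (a : R) (v : X) (y : dual_space X) :
  pairing (a *: v) y = a * pairing v y.
Proof.
by have := pairing_linearl y a v 0; rewrite /pair pairing0 !addr0.
Qed.

Lemma closed_weakly_closed C :
  @closed (weak_topology X) C -> weakly_closed pair C.
Proof.
move=> Ccl x Cx.
have /open_nbhs_nbhs : @open_nbhs (weak_topology X) x (~` C).
  by split => //; exact: closed_openC.
move=> /nbhs_sup_initial[s [eps eps0 sC]]; exists s; exists eps => // z zs.
by apply: sC => y /zs; rewrite /pair pairingD -scaleN1r pairingZ mulN1r.
Qed.

Lemma closed_weakly_star_closed D :
  @closed (weak_star_topology X) D -> weakly_closed (fun y x => pair x y) D.
Proof.
move=> Dcl y Dy.
have /open_nbhs_nbhs : @open_nbhs (weak_star_topology X) y (~` D).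
  by split => //; exact: closed_openC.
by move=> /nbhs_sup_initial[s [eps eps0 sD]]; exists s; exists eps => // z /sD.
Qed.

Lemma bipolar C : convex_cone C -> @closed (weak_topology X) C ->
  predual_cone (dual_cone C) = C.
Proof.
move=> Cc /closed_weakly_closed Ccl; apply/seteqP; split; last first.
  by move=> x Cx y; apply.
move=> x xC; apply: contrapT => Cx.
have [y [yC]] := weak_separation pairing_linearl pairing_linearr Cc Ccl Cx.
by apply/negP; rewrite -leNgt; exact: xC.
Qed.

Lemma bipolar_star D : convex_cone D -> @closed (weak_star_topology X) D ->
  dual_cone (predual_cone D) = D.
Proof.
move=> Dc /closed_weakly_star_closed Dcl; apply/seteqP; split; last first.
  by move=> y Dy x; apply.
move=> y yD; apply: contrapT => Dy.
have [x [xD]] := weak_separation pairing_linearr pairing_linearl Dc Dcl Dy.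
by apply/negP; rewrite -leNgt; exact: yD.
Qed.

Lemma predual_convex_cone D : convex_cone (predual_cone D).
Proof.
split=> [y _|l x l0 Dx y /Dx yx|u v Du Dv y Dy].
- by rewrite pairing0.
- by rewrite pairingZ mulr_ge0// ltW.
- by rewrite pairingD addr_ge0//; [exact: Du|exact: Dv].
Qed.

End duality.

(** * Interiors of convex cones *)

Section interior_of_cones.
Context (R : realType) (E : preTopologicalLmodType R).
Hypothesis addE : continuous (fun x : E * E => x.1 + x.2).
Hypothesis scaleE : continuous (fun z : R^o * E => z.1 *: z.2).
Implicit Types (C : set E) (x v e : E).

Lemma add_scale_continuous (U : topologicalType) (k : U -> R^o) (h : U -> E) a :
  continuous k -> continuous h -> continuous (fun u => a + k u *: h u).
Proof.
move=> kc hc u.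
have khu := @continuous2_cvg _ _ _ _ (nbhs u) (nbhs_filter u)
  k h (fun (r : R^o) x => r *: x) _ _ (@scaleE (k u, h u)) (kc u) (hc u).
exact: (@continuous2_cvg _ _ _ _ (nbhs u) (nbhs_filter u)
  (cst a) _ (fun x y : E => x + y) _ _ (@addE (a, k u *: h u))
  (@cvg_cst E a U (nbhs u) (nbhs_filter u)) khu).
Qed.

Lemma nbhs_segment C e v : nbhs e C -> exists2 t : R, 0 < t & C (e + t *: v).
Proof.
move=> eC; have fc : continuous (fun t : R^o => e + t *: v).
  by apply: add_scale_continuous => t; [exact: cvg_id|exact: cvg_cst].
have := fc 0; rewrite /continuous_at scale0r addr0 => /(_ C eC).
move=> /nbhs_ballP[d /= d0 dC]; exists (d / 2); first exact: divr_gt0.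
apply: dC; rewrite -ball_normE /= sub0r normrN gtr0_norm ?divr_gt0//.
by rewrite ltr_pdivrMr// ltr_pMr// ltr1n.
Qed.

Lemma nbhs_affine C a (k : R) x :
  nbhs (a + k *: x) C -> nbhs x [set z | C (a + k *: z)].
Proof.
move=> xC; have fc : continuous (fun z : E => a + k *: z).
  by apply: add_scale_continuous => t; [exact: cvg_cst|exact: cvg_id].
exact: (fc x C xC).
Qed.

Lemma interior_coneD C x y : convex_cone C -> C x -> C° y -> C° (x + y).
Proof.
move=> [_ _ Cd] Cx Cy.
have : nbhs (x + y) [set z | C (- x + 1 *: z)].
  by apply: nbhs_affine; rewrite scale1r addKr.
apply: filterS => z; rewrite /= scale1r => /(Cd _ _ Cx).
by rewrite addNKr.
Qed.

Lemma interior_coneZ C (l : R) x :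
  convex_cone C -> 0 < l -> C° x -> C° (l *: x).
Proof.
move=> [_ Cl _] l0 Cx.
have : nbhs (l *: x) [set z | C (0 + l^-1 *: z)].
  by apply: nbhs_affine; rewrite add0r scalerA mulVf ?gt_eqF// scale1r.
apply: filterS => z; rewrite /= add0r => /(Cl _ _ l0).
by rewrite scalerA divff ?gt_eqF// scale1r.
Qed.

Lemma interior_cone0 C x : convex_cone C -> C° 0 -> C° x.
Proof.
move=> Cc C0; have [_ Cl _] := Cc.
have [t t0] := nbhs_segment x C0; rewrite add0r.
have ti : 0 < t^-1 by rewrite invr_gt0.
move/(Cl _ _ ti); rewrite scalerA mulVf ?gt_eqF// scale1r => Cx.
by rewrite -[x]addr0; exact: interior_coneD.
Qed.

(** With 0 <= g on a neighbourhood of e, symmetrising around e gives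
    - g e <= g <= g e on a neighbourhood of 0. *)
Lemma positive_continuous C e (g : E -> R^o) : linear g ->
  (forall c, C c -> 0 <= g c) -> C° e -> continuous g.
Proof.
move=> lg gC Ce p.
have ge0 : 0 <= g e by apply: gC; exact: interior_subset.
apply/cvgrPdist_le => eps eps0.
(* Both e + k (z - p) and e - k (z - p) lie in C for z near p, so that
   k |g z - g p| <= g e.  The added 1 keeps k positive. *)
pose k := (g e + 1) / eps.
have k0 : 0 < k by rewrite divr_gt0// ltr_wpDl.
have side (a : R) : nbhs p [set z | C ((e - a *: p) + a *: z)].
  by apply: nbhs_affine; rewrite subrK.
near=> z.
have gB (a : R) : C ((e - a *: p) + a *: z) -> 0 <= g e + a * (g z - g p).
  have -> : (e - a *: p) + a *: z = a *: (-1 *: p + z) + e.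
    by rewrite scaleN1r scalerDr scalerN -addrA addrC.
  by move=> /gC; rewrite !lg /GRing.scale/= mulN1r addrC (addrC (- g p)).
have h1 : 0 <= g e + k * (g z - g p) by apply: gB; near: z; exact: side.
have h2 : 0 <= g e + (- k) * (g z - g p) by apply: gB; near: z; exact: side.
suff : k * `|g p - g z| <= k * eps by rewrite ler_pM2l.
have -> : k * eps = g e + 1 by rewrite /k divfK// gt_eqF.
rewrite distrC -{1}(gtr0_norm k0) -normrM ler_norml.
by apply/andP; split; lra.
Unshelve. all: by end_near. Qed.

(** Apply [positive_functional] to the cone generated by C and - x.  If it
    contained - e = c - s x, then s x = c + e would be interior to C, and so
    would x. *)
Lemma interior_separation C e x : convex_cone C -> C° e -> ~ C° x ->
  exists g : E -> R^o, [/\ continuous_functional g,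
    forall c, C c -> 0 <= g c, g e = 1 & g x <= 0].
Proof.
move=> Cc Ce Cx; have [C0 Cl Cd] := Cc.
pose K := [set c - s *: x | c in C & s in [set s : R | 0 <= s]].
have CK : C `<=` K.
  by move=> c Cc'; exists c => //; exists 0 => //=; rewrite scale0r subr0.
have Kc : convex_cone K.
  split; first exact: CK.
  - move=> l _ l0 [c Cc' [s /= s0 <-]]; exists (l *: c); first exact: Cl.
    exists (l * s); first by rewrite /= mulr_ge0// ltW.
    by rewrite scalerBr scalerA.
  - move=> _ _ [c Cc' [s /= s0 <-]] [d Cd' [r /= r0 <-]].
    exists (c + d); first exact: Cd.
    exists (s + r); first by rewrite /= addr_ge0.
    by rewrite scalerDl opprD addrACA.
have Ke : ~ K (- e).
  move=> [c Cc' [s /= s0]] /(canRL (subrK _)) ce.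
  have : C° (s *: x).
    have -> : s *: x = c + e by rewrite ce addrC addrA subrr add0r.
    exact: interior_coneD.
  (* For s = 0, the origin is interior to C and C is the whole space. *)
  move: s0; rewrite le_eqVlt => /predU1P[<-|s0 sx].
    by rewrite scale0r => /(interior_cone0 x Cc).
  apply: Cx; have si : 0 < s^-1 by rewrite invr_gt0.
  by have := interior_coneZ Cc si sx; rewrite scalerA mulVf ?gt_eqF// scale1r.
have [|g [lg gK g1]] := positive_functional Kc Ke.
  by move=> v; have [t t0 /CK] := nbhs_segment v Ce; exists t.
exists g; split => //.
- split => //; apply: (@positive_continuous C e) => // c /CK; exact: gK.
- by move=> c /CK; exact: gK.
- have : K (-1 *: x).
    by exists 0 => //; exists 1 => //=; rewrite sub0r scale1r scaleN1r.
  move=> /gK; have := lg (-1) x 0.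
  have -> : g 0 = 0.
    by have := lg (-1) 0 0; rewrite scaler0 addr0 scaleN1r addNr.
  by rewrite !addr0 => ->; rewrite /GRing.scale/= mulN1r oppr_ge0.
Qed.

(** From e, a short step in the direction in which g decreases stays in C. *)
Lemma interior_positive C e (g : E -> R^o) v : linear g ->
  (forall c, C c -> 0 <= g c) -> C° e -> g v != 0 -> 0 < g e.
Proof.
move=> lg gC Ce gv.
have [t t0 /gC] := nbhs_segment (- g v *: v) Ce.
rewrite addrC scalerA lg /GRing.scale/= => h.
have : 0 < t * (g v * g v) by rewrite mulr_gt0// -expr2 exprn_even_gt0.
by lra.
Qed.

End interior_of_cones.

Section interior_duality.
Context (R : realType) (X : preTopologicalLmodType R) (tau : Topological X).
Hypotheses (lc : locally_convex_topology tau) (cons : consistent tau).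
Let E : preTopologicalLmodType R := retopologize tau.

(** The functionals that detect the interior for tau are those of the dual of X
    for its original topology: this is where consistency enters. *)
Lemma interior_dual_cone (C : set X) : convex_cone C ->
  @interior E C !=set0 ->
  @interior E C =
    [set x | forall y, (dual_cone C `\` [set 0]) y -> 0 < pairing x y].
Proof.
move=> Cc [e Ce]; have [addE scaleE _] := lc.
apply/seteqP; split=> [x Cx y [yC y0]|x xC].
  have [v yv] : exists v, pairing v y != 0.
    apply: contrapT => /forallNP yv; apply: y0; apply/val_inj/funext => v.
    exact/eqP/negPn/negP/yv.
  exact: (@interior_positive R E addE scaleE C x (functional y) v
    (pairing_linearl y) yC Cx yv).
apply: contrapT => Cx.
have [g [gc gC ge gx]] := @interior_separation R E addE scaleE C e x Cc Ce Cx.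
have gP : (g : X -> R^o) \in @dual_pred R X.
  by apply/asboolP; rewrite -cons.
pose y := DualSpace gP.
have /xC : (dual_cone C `\` [set 0]) y.
  split; first exact: gC.
  move=> /(congr1 (fun z : dual_space X => z e)) /=; rewrite ge => /eqP.
  by rewrite oner_eq0.
by rewrite ltNge => /negP; apply.
Qed.

(** A point a of A is the limit, as t tends to 0, of the points a + t e, which
    are interior to A when e is; nonnegativity passes to the limit. *)
Lemma interior_sub_predual (A : set X) (D : set (dual_space X)) :
  convex_cone A -> @interior E A !=set0 ->
  @interior E A `<=` predual_cone D -> A `<=` predual_cone D.
Proof.
move=> Ac [e Ae] AD a Aa y Dy; have [addE scaleE _] := lc.
apply/ler_addgt0Pr => d d0.
have [t t0 td] : exists2 t : R, 0 < t & t * @pairing R X e y <= d.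
  have p0 : 0 < `|@pairing R X e y| + 1 by rewrite ltr_wpDl.
  exists (d / (`|@pairing R X e y| + 1)); first exact: divr_gt0.
  rewrite mulrAC ler_pdivrMr// ler_pM2l// (le_trans (ler_norm _))//.
  by rewrite lerDl.
have : @interior E A (a + t *: e).
  by apply: (@interior_coneD R E addE scaleE) => //; exact: interior_coneZ.
move=> /AD/(_ _ Dy); rewrite pairingD pairingZ => /le_trans; apply.
by rewrite lerD2l.
Qed.

End interior_duality.

(** * The duality theorem *)

Theorem theorem3p10 (R : realType) (X : tvsType R) (hX : hausdorff_space X)
    (C : set X) (D : set (dual_space X))
    (C_cone : cone C) (C_convex : convex_set C)
    (C_closed : @closed (weak_topology X) C)
    (D_cone : cone D) (D_convex : convex_set D)
    (D_closed : @closed (weak_star_topology X) D) :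
  (D = dual_cone C <-> C = predual_cone D) /\
  (forall tau : Topological X,
     locally_convex_topology tau -> consistent tau ->
     @interior (retopologize tau) C !=set0 ->
     @interior (retopologize tau) (predual_cone D) !=set0 ->
     let iii := @interior (retopologize tau) C =
       [set x | forall y, (D `\` [set 0]) y -> 0 < pairing x y] in
     (D = dual_cone C <-> iii) /\ (C = predual_cone D <-> iii)).
Proof.
have Cc : convex_cone C.
  apply: cone_convex_cone => //.
  apply: (weakly_closed0 (@pairing_linearl R X)) => //.
  exact: closed_weakly_closed.
have Dc : convex_cone D.
  apply: cone_convex_cone => //.
  apply: (weakly_closed0 (@pairing_linearr R X)) => //.
  exact: closed_weakly_star_closed.
have CC := bipolar Cc C_closed.
have DD := bipolar_star Dc D_closed.
have i_ii : D = dual_cone C <-> C = predual_cone D.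
  by split=> ->; rewrite ?CC ?DD.
split => // tau lc cons C0 D0 iii.
have Pc := predual_convex_cone D.
have i_iii : D = dual_cone C -> iii.
  by move=> DC; rewrite /iii DC; exact: interior_dual_cone.
have iii_ii : iii -> C = predual_cone D.
  (* The dual cone of D' is D, so the right-hand side of iii is int D'. *)
  move=> int; have := interior_dual_cone lc cons Pc D0; rewrite DD -int => PC.
  apply/seteqP; split.
    apply: (interior_sub_predual lc) => //.
    by rewrite -PC; exact: interior_subset.
  rewrite -[X in _ `<=` X]CC; apply: (interior_sub_predual lc) => //.
  by rewrite PC CC; exact: interior_subset.
by split; split=> [/i_ii|] //; rewrite ?i_ii //; move=> /i_ii.
Qed.
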